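(* Let $S\subset\mathbb{R}^d$ be nonempty and closed. Suppose that $g:S\to[-\infty,\infty]$, $h\in\mathrm{usc\text{-}fcns}(S)$, $\{f,f^n,n\in\mathbb{N}\}\subset\mathrm{usc\text{-}fcns}(S)$, and $f^n\to f$. If $g(x)\leq f^n(x)\leq h(x)$ for all $n\in\mathbb{N}$ and $x\in S$, then $g(x)\leq f(x)\leq h(x)$ for all $x\in S$.
   Context: $\mathrm{usc\text{-}fcns}(S)$ is the set of upper semicontinuous functions $f:S\to[-\infty,\infty]$ with $f\not\equiv-\infty$. Convergence $f^n\to f$ means hypo-convergence (equivalently, convergence in the Attouch-Wets distance between hypographs): $\limsup f^n(x^n)\leq f(x)$ for all $x\in S$ and all $x^n\in S\to x$, and for every $x\in S$ there is $x^n\in S\to x$ with $\liminf f^n(x^n)\geq f(x)$. *)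

(* Defs.v *)
From HB Require Import structures.
From mathcomp Require Import all_boot all_order all_algebra.
From mathcomp Require Import all_classical all_reals all_analysis.
Set Implicit Arguments.
Unset Strict Implicit.
Unset Printing Implicit Defensive.
Import Order.TTheory GRing.Theory Num.Theory.
Import numFieldNormedType.Exports.
Local Open Scope classical_set_scope.
Local Open Scope ring_scope.
Local Open Scope ereal_scope.

(* A function S -> [-oo, +oo] on S : set 'rV[R]_d has the subtype [set_type S]
   as its domain, with the topology induced by R^d. *)

Definition upper_semicontinuous (R : realType) (X : topologicalType)
  (f : X -> \bar R) : Prop := lower_semicontinuous (\- f).

Lemma upper_semicontinuousP (R : realType) (X : topologicalType)
  (f : X -> \bar R) :
  upper_semicontinuous f <->
  forall x (a : R), f x < a%:E ->
    exists2 V, nbhs x V & forall y, V y -> f y < a%:E.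
Proof.
split=> uf x a /= fxa.
- have [|V nV VP] := uf x (- a)%R; first by rewrite /= EFinN lteN2.
  by exists V => // y /VP; rewrite /= EFinN lteN2.
- have [|V nV VP] := uf x (- a)%R; first by rewrite EFinN lteNr.
  by exists V => // y /VP; rewrite EFinN lteNr.
Qed.

Definition usc_fcns (R : realType) (d : nat) (S : set 'rV[R]_d) :
    set (S -> \bar R) :=
  [set f | upper_semicontinuous f /\ f <> cst -oo].
Arguments usc_fcns {R d} S _.

Definition hypo_converges (R : realType) (d : nat) (S : set 'rV[R]_d)
    (fn : nat -> S -> \bar R) (f : S -> \bar R) : Prop :=
  (forall (x : S) (xn : nat -> S), xn @ \oo --> x ->
     limn_esup (fun n => fn n (xn n)) <= f x) /\
  (forall x : S, exists2 xn : nat -> S, xn @ \oo --> x &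
     f x <= limn_einf (fun n => fn n (xn n))).

(* Main.v *)
Require Import Defs.
From mathcomp Require Import all_boot all_order all_algebra.
From mathcomp Require Import all_classical all_reals all_analysis.
Import Order.TTheory GRing.Theory Num.Theory.
Import numFieldNormedType.Exports.
Local Open Scope classical_set_scope.
Local Open Scope ring_scope.
Local Open Scope ereal_scope.

(* The lower bound follows from the limsup inequality along the constant
   sequence x. For the upper bound, along a recovery sequence x^n -> x the
   values f^n(x^n) <= h(x^n) are eventually below any real a > h(x), by upper
   semicontinuity of h. *)

(** The limsup is the infimum of the suprema over neighbourhoods of [\oo], and each of these
    contains some [n] with [l <= u n]. *)
Lemma le_limn_esup_near (R : realType) (u : (\bar R)^nat) (l : \bar R) :
  (\forall n \near \oo, l <= u n) -> l <= limn_esup u.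
Proof.
move=> lu; rewrite /limn_esup limf_esupE.
apply: le_ereal_inf_tmp => _ [V oV <-].
have [n [Vn lun]] := filter_ex (filterI oV lu).
by apply: le_ereal_sup_tmp; exists (u n) => //; exists n.
Qed.

Lemma limn_esup_le_near (R : realType) (u : (\bar R)^nat) (l : \bar R) :
  (\forall n \near \oo, u n <= l) -> limn_esup u <= l.
Proof.
move=> ul; rewrite /limn_esup limf_esupE.
apply: ge_ereal_inf; exists (ereal_sup (u @` [set n | u n <= l])).
  by exists [set n | u n <= l].
by apply: ge_ereal_sup => _ [n + <-].
Qed.

(** Reduces a bound by a possibly infinite [h x] to real bounds, the form in which upper
    semicontinuity is usable. *)
Lemma lee_forall_gt_real (R : realType) (x y : \bar R) :
  (forall a : R, x < a%:E -> y <= a%:E) -> y <= x.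
Proof.
case: x => [r||] yx; last 2 first.
- exact: leey.
- case: y yx => [s||] // yx.
    (* For [x = -oo] and [y = s] real, the bound [s - 1] is absurd. *)
    by have := yx (s - 1)%R (ltNyr _); rewrite lee_fin lerBrDr gerDl ler10.
  by have := yx 0%R (ltNyr _); rewrite leye_eq.
- apply/lee_addgt0Pr => e e0; rewrite -EFinD.
  by apply: yx; rewrite lte_fin ltrDl.
Qed.

Theorem proposition4p5 (R : realType) (d : nat) (S : set 'rV[R]_d)
  (S_neq0 : S !=set0) (S_closed : closed S)
  (g h f : S -> \bar R) (fn : nat -> S -> \bar R)
  (h_usc : usc_fcns S h) (f_usc : usc_fcns S f)
  (fn_usc : forall n, usc_fcns S (fn n))
  (fn_cvg : hypo_converges fn f)
  (gfnh : forall n x, g x <= fn n x <= h x) :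
  forall x, g x <= f x <= h x.
Proof.
move=> x; have [limsup_le recovery] := fn_cvg.
apply/andP; split.
  apply: le_trans (limsup_le x (fun=> x) (cvg_cst x)).
  by apply: le_limn_esup_near; near=> n; have /andP[] := gfnh n x.
have [xn xn_x fx_le] := recovery x.
apply: lee_forall_gt_real => a hxa; have [h_usc' _] := h_usc.
have [V Vx hV] := (upper_semicontinuousP h).1 h_usc' x a hxa.
(* As liminf is at most limsup, it is enough to bound the limsup along [xn] by [a]. *)
apply: le_trans fx_le (le_trans (limn_einf_sup _) _).
apply: limn_esup_le_near; near=> n.
have /andP[_ fnh] := gfnh n (xn n).
apply: le_trans fnh (ltW (hV _ _)).
by near: n; exact: xn_x.
Unshelve. all: by end_near.
Qed.
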